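(* There exist transcendental entire functions $f$ and $g$ and a domain in $\mathbb{C}$ which lies in a periodic component of $F(f)$ and in a wandering component of $F(g)$, and also lies in a wandering component of $F(g\circ f)$ and in a wandering component of $F(f\circ g)$.
   Context: A domain is a nonempty open connected subset of $\mathbb{C}$. For a transcendental entire function $h$, $h^n$ denotes its $n$-th iterate, and the Fatou set is $F(h)=\{z\in\mathbb{C}: \{h^n\}_{n\in\mathbb{N}} \text{ is normal in some neighborhood of } z\}$. A component of $F(h)$ means a connected component. For a component $U$ of $F(h)$ and $k\ge 0$, let $U_k$ denote the component of $F(h)$ containing $h^k(U)$ (so $U_0=U$). The component $U$ is called wandering if $U_k\cap U_l=\emptyset$ for all $k\neq l$; otherwise it is called preperiodic. It is called periodic if $U_k=U$ for some $k\ge 1$. A domain lies in a wandering (resp. periodic, preperiodic) component of $h$ if it is contained in some wandering (resp. periodic, preperiodic) component of $F(h)$. If $f,g$ are transcendental entire, so are $f\circ g$ and $g\circ f$, and these notions apply to them. *)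

(* Defs.v *)
(* The complex plane is R[i] for R : realType, taken as the
   regular module R[i]^o, which carries the topology and norm of R[i]. *)
From HB Require Import structures.
From mathcomp Require Import all_boot all_order all_algebra complex.
From mathcomp Require Import all_classical all_reals all_analysis.

Set Implicit Arguments.
Unset Strict Implicit.
Unset Printing Implicit Defensive.

Import Order.TTheory GRing.Theory Num.Theory.
Import numFieldNormedType.Exports.

Local Open Scope classical_set_scope.
Local Open Scope ring_scope.
Local Open Scope complex_scope.

(* The increments in derivable range over the scalars R[i], so this is complex
   differentiability. *)
Definition entire (R : realType) (f : R[i]^o -> R[i]^o) : Prop :=
  forall z : R[i]^o, derivable f z 1.

Definition transcendental_entire (R : realType) (f : R[i]^o -> R[i]^o) : Prop :=
  entire f /\ ~ exists p : {poly R[i]}, forall z : R[i], f z = p.[z].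

Definition domain (R : realType) (D : set R[i]^o) : Prop :=
  [/\ D !=set0, open D & connected D].

(* Locally uniform convergence to infinity. *)
Definition diverges_compactly (R : realType) (V : set R[i]^o)
    (u : nat -> R[i]^o -> R[i]^o) : Prop :=
  forall (K : set R[i]^o) (M : R), compactly_in V K ->
    \forall n \near \oo, forall z : R[i]^o, K z -> M%:C < `|u n z|.

(* When V is not connected this asks for one alternative on all of V; the Fatou
   set is unaffected, since a neighborhood may be shrunk to a disc. *)
Definition normal_family (R : realType) (V : set R[i]^o)
    (F : set (R[i]^o -> R[i]^o)) : Prop :=
  forall u : nat -> R[i]^o -> R[i]^o, (forall n, F (u n)) ->
  exists2 phi : nat -> nat, {homo phi : m n / (m < n)%N} &
    (exists l : R[i]^o -> R[i]^o,
        {family compactly_in V, (fun n => u (phi n)) @ \oo --> l})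
    \/ diverges_compactly V (fun n => u (phi n)).

Definition Fatou (R : realType) (h : R[i]^o -> R[i]^o) : set R[i]^o :=
  [set z | exists2 V : set R[i]^o, open_nbhs z V &
             normal_family V (range (fun n : nat => iter n h))].

Definition Fatou_component (R : realType) (h : R[i]^o -> R[i]^o)
    (U : set R[i]^o) : Prop :=
  exists2 z : R[i]^o, Fatou h z & U = connected_component (Fatou h) z.

(* V is U_k, the component of F(h) containing h^k(U). *)
Definition image_component (R : realType) (h : R[i]^o -> R[i]^o)
    (U : set R[i]^o) (k : nat) (V : set R[i]^o) : Prop :=
  Fatou_component h V /\ iter k h @` U `<=` V.

Definition periodic_component (R : realType) (h : R[i]^o -> R[i]^o)
    (U : set R[i]^o) : Prop :=
  Fatou_component h U /\ exists2 k : nat, (0 < k)%N & image_component h U k U.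

Definition wandering_component (R : realType) (h : R[i]^o -> R[i]^o)
    (U : set R[i]^o) : Prop :=
  Fatou_component h U /\
  exists2 W : nat -> set R[i]^o, (forall k, image_component h U k (W k)) &
    forall k l : nat, k <> l -> W k `&` W l = set0.

Definition lies_in_periodic (R : realType) (h : R[i]^o -> R[i]^o)
    (D : set R[i]^o) : Prop :=
  exists2 U : set R[i]^o, periodic_component h U & D `<=` U.

Definition lies_in_wandering (R : realType) (h : R[i]^o -> R[i]^o)
    (D : set R[i]^o) : Prop :=
  exists2 U : set R[i]^o, wandering_component h U & D `<=` U.

(* Main.v *)
Require Import Defs.
From HB Require Import structures.
From mathcomp Require Import all_boot all_order all_algebra complex.
From mathcomp Require Import all_classical all_reals all_analysis.
From mathcomp Require Import ring lra.

(** The functions are f(z) = z - 1 + e^{-z}, which is the Newton map of e^z - 1,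
    and g = f + tau with tau = 2 pi i.  The zeros of e^z - 1 are the multiples
    of tau, and each of them is a superattracting fixed point of f.  Moreover f
    commutes with the translation by tau, so that g o f = f o g = f^2 + tau.
    The maps to study besides f are thus h = f^b + tau with b = 1 or b = 2, and
    h^n = f^{bn} + n tau.

    Let D be a small disc around 0.  Since f^n tends to 0 uniformly on D
    (lemma iter_newton_near0), D lies in the Fatou set of f, and it lies in that
    of h because there h^n tends to infinity with n tau.  For f the component
    that contains D is mapped into itself, as f(0) = 0.  For h the images of
    the component that contains D lie in the components that contain the
    points k tau, and it remains to see that these are pairwise distinct.

    They are distinct because each horizontal line Im z = (2k+1) pi is disjoint
    from the Fatou set of h (lemma odd_line_Julia): a connected subset of the
    Fatou set that contains two multiples of tau would have to cross such a
    line.  On these lines e^{-z} is negative, so f preserves them, moves their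
    points to the left, and has derivative 1 + e^{-Re z} there, which is huge
    far to the left.  Given z on such a line, far to the left, the disc of
    radius 10 around f^N(z) can therefore be pulled back by f^N to a disc of
    radius 10 / 2^N around z (lemma pullback).  The disc of radius 10 is large
    enough for e^{-v} to take on it all values in some annular sector of radii
    comparable to e^{-Re f^N(z)}; hence one can choose v in it with f(v) at
    bounded distance from m - n tau, where N + 1 + m = b n.  In the right half
      plane f is
    nearly the translation by -1, so m further iterations lead to a bounded
    distance from - n tau.  Altogether, arbitrarily close to z there is a point
    that h^n maps into a fixed bounded set (lemma bounded_return), whereas
    h^n(z) tends to infinity.  No subsequence of these h^n converges at z or
    diverges to infinity uniformly near z.

    The remaining point is that h maps its Fatou set into itself (lemma
    newton_shift_image), which is needed to speak of the images of components.
    Where f has nonzero derivative it is open; this comes from the contraction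
    principle in the form of lemma newton_covers_disc, which also gives the
    pullbacks above.  The critical points of f are the multiples of tau, and
    these are already known to belong to the Fatou set. *)

Set Implicit Arguments.
Unset Strict Implicit.
Unset Printing Implicit Defensive.

Import Order.TTheory GRing.Theory Num.Theory.
Import numFieldNormedType.Exports.

Local Open Scope classical_set_scope.
Local Open Scope ring_scope.
Local Open Scope complex_scope.

Local Notation modulus := Normc.normc.

(** * The real-valued modulus *)

Section Modulus.
Context {R : realType}.
Implicit Types z w : R[i].

Lemma ReD z w : complex.Re (z + w) = complex.Re z + complex.Re w.
Proof. by case: z; case: w. Qed.

Lemma ImD z w : complex.Im (z + w) = complex.Im z + complex.Im w.
Proof. by case: z; case: w. Qed.

Lemma ReN z : complex.Re (- z) = - complex.Re z.
Proof. by case: z. Qed.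

Lemma ImN z : complex.Im (- z) = - complex.Im z.
Proof. by case: z. Qed.

Lemma Re_nat n : complex.Re (n%:R : R[i]) = n%:R.
Proof. by rewrite -(rmorph_nat (real_complex R)). Qed.

Lemma Im_nat n : complex.Im (n%:R : R[i]) = 0.
Proof. by rewrite -(rmorph_nat (real_complex R)). Qed.

(** The norm of R[i] takes its values in R[i] itself, whose order is partial;
    estimates are carried out with this real-valued form instead. *)
Lemma normE z : `|z| = (modulus z)%:C.
Proof. by []. Qed.

Lemma modulus_ge0 z : 0 <= modulus z.
Proof. by rewrite -ler0c -normE. Qed.

Lemma modulusD z w : modulus (z + w) <= modulus z + modulus w.
Proof. exact: le_normcD. Qed.

Lemma modulusB z w : modulus (z - w) <= modulus z + modulus w.
Proof. by rewrite -(normcN w); exact: modulusD. Qed.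

Lemma modulus_distC z w : modulus (z - w) = modulus (w - z).
Proof. by rewrite -normcN opprB. Qed.

Lemma modulus_triangle u z w :
  modulus (z - w) <= modulus (z - u) + modulus (u - w).
Proof. by rewrite (le_trans _ (modulusD _ _))// addrA subrK. Qed.

Lemma modulus_Re z : `|complex.Re z| <= modulus z.
Proof. by rewrite -lecR; exact: normc_ge_Re. Qed.

Lemma modulus_Im z : `|complex.Im z| <= modulus z.
Proof.
case: z => a b /=; rewrite -sqrtr_sqr ler_sqrt ?lerDr ?sqr_ge0//.
by rewrite addr_ge0 ?sqr_ge0.
Qed.

Lemma modulus_le z : modulus z <= `|complex.Re z| + `|complex.Im z|.
Proof.
case: z => a b /=.
rewrite -[leRHS]ger0_norm ?addr_ge0// -sqrtr_sqr ler_sqrt ?sqr_ge0//.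
by rewrite sqrrD !real_normK ?num_real// lerD2r lerDl mulrn_wge0// mulr_ge0.
Qed.

Lemma modulus_sqr z : modulus z ^+ 2 = complex.Re z ^+ 2 + complex.Im z ^+ 2.
Proof. by case: z => a b /=; rewrite sqr_sqrtr// addr_ge0 ?sqr_ge0. Qed.

Lemma modulus_real (x : R) : modulus x%:C = `|x|.
Proof. by rewrite /= expr0n addr0 sqrtr_sqr. Qed.

Lemma nbhs_modulus (z : R[i]^o) (A : set R[i]^o) :
  nbhs z A <-> exists2 r : R, 0 < r & forall w, modulus (w - z) < r -> A w.
Proof.
split.
  move=> /nbhs_ballP [e /= e0 eA]; exists (complex.Re e).
    by move: e0; rewrite ltcE /= => /andP[].
  move=> w wz; apply: eA; rewrite -ball_normE/= distrC normE.
  have -> : e = (complex.Re e)%:C by rewrite RRe_real// gtr0_real.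
  by rewrite ltcR.
move=> [r r0 rA]; apply/nbhs_ballP; exists r%:C => /=; first by rewrite ltcR.
by move=> w; rewrite -ball_normE/= distrC normE ltcR; exact: rA.
Qed.

Lemma continuous_modulus (f : R[i]^o -> R[i]^o) (z : R[i]^o) :
  (forall e, 0 < e -> exists2 r, 0 < r &
     forall w, modulus (w - z) < r -> modulus (f w - f z) < e) ->
  {for z, continuous f}.
Proof.
move=> fz A /nbhs_modulus[e /fz[r r0 rf] eA].
by apply/nbhs_modulus; exists r => // w /rf/eA.
Qed.

End Modulus.

(** * A contraction principle in the complex plane *)

Section ContractionPrinciple.
Context {R : realType}.

Lemma small_div_exp2 (c e : R) : 0 < e ->
  exists N, forall n, (N <= n)%N -> c / 2 ^+ n < e.
Proof.
move=> e0; exists (Num.bound (c / e)) => n /upper_nthrootP.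
by rewrite ltr_pdivrMr// mulrC ltr_pdivrMr// exprn_gt0.
Qed.

(** The intervals of radius 2d / 2^n around x n are nested, so the supremum of
    their left endpoints lies in all of them. *)
Lemma geometric_limit (x : nat -> R) (d : R) :
    (forall n, `|x n.+1 - x n| <= d / 2 ^+ n) ->
  exists l, forall n, `|l - x n| <= d *+ 2 / 2 ^+ n.
Proof.
move=> xd; pose e n := d *+ 2 / 2 ^+ n.
have eS n : e n = d / 2 ^+ n + e n.+1.
  by rewrite /e exprS; field; rewrite expf_neq0.
have d0 n : 0 <= d / 2 ^+ n by exact: le_trans (normr_ge0 _) (xd n).
have incr : {homo (fun n => x n - e n) : m n / (m <= n)%N >-> m <= n}.
  apply: homo_leq => [//|y a b|n]; first exact: le_trans.
  by have := xd n; rewrite ler_norml /= [e n]eS => /andP[]; lra.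
have decr : {homo (fun n => x n + e n) : m n / (m <= n)%N >-> n <= m}.
  apply: homo_leq => [//|y a b|n]; first by move=> h1 h2; exact: le_trans h2 h1.
  by have := xd n; rewrite ler_norml /= [e n]eS => /andP[]; lra.
have e0 n : 0 <= e n.
  by rewrite /e mulrnAl mulrn_wge0.
have sep m n : x m - e m <= x n + e n.
  rewrite (le_trans (incr _ _ (leq_maxl m n)))//.
  rewrite (le_trans _ (decr _ _ (leq_maxr m n)))//.
  by have := e0 (maxn m n); lra.
pose S : set R := range (fun n => x n - e n).
have S0 : S !=set0 by exists (x 0%N - e 0%N), 0%N.
exists (sup S) => n; rewrite ler_norml lerBlDl lerNl opprB lerBlDl -lerBlDr;
  apply/andP; split.
  have /ubP -> // : ubound S (sup S); last by exists n.
  by apply: ub_le_sup; exists (x 0%N + e 0%N) => _ [m _ <-].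
by apply: ge_sup => // _ [m _ <-].
Qed.

(** The orbit of 0 moves by at most d / 2^n at step n; the previous lemma gives
    the limits of its real and imaginary parts. *)
Lemma fixed_point_disc (P : R[i] -> R[i]) (d : R) : 0 <= d ->
    (forall w, modulus w <= d -> modulus (P w) <= d) ->
    (forall w w', modulus w <= d -> modulus w' <= d ->
       modulus (P w - P w') <= modulus (w - w') / 2) ->
  exists2 p, modulus p <= d & P p = p.
Proof.
move=> d0 Pd Plip; pose w n := iter n P 0.
have wd n : modulus (w n) <= d.
  by elim: n => [|n IH]; [rewrite Normc.normc0|exact: Pd].
have step n : modulus (w n.+1 - w n) <= d / 2 ^+ n.
  elim: n => [|n IH]; first by rewrite /= subr0 expr0 divr1; exact: Pd (wd 0%N).
  apply: le_trans (Plip (w n.+1) (w n) (wd _) (wd _)) _.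
  by rewrite exprSr invfM mulrA ler_pM2r.
have /geometric_limit[a aw] n :
    `|complex.Re (w n.+1) - complex.Re (w n)| <= d / 2 ^+ n.
  by rewrite (le_trans _ (step n))// -ReN -ReD modulus_Re.
have /geometric_limit[b bw] n :
    `|complex.Im (w n.+1) - complex.Im (w n)| <= d / 2 ^+ n.
  by rewrite (le_trans _ (step n))// -ImN -ImD modulus_Im.
pose p := a +i* b.
have pw n : modulus (p - w n) <= d *+ 4 / 2 ^+ n.
  rewrite (le_trans (modulus_le _))// ReD ImD ReN ImN.
  rewrite (le_trans (lerD (aw n) (bw n)))//.
  by rewrite -mulrDl -mulrnDr.
have small (c x : R) : (forall n, x <= c / 2 ^+ n) -> x <= 0.
  move=> xc; rewrite leNgt; apply/negP => /(small_div_exp2 c)[N] /(_ N).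
  by move=> /(_ (leqnn N)); rewrite ltNge xc.
have pd : modulus p <= d.
  rewrite -subr_le0; apply: (small (d *+ 4)) => n; rewrite lerBlDr.
  by rewrite -[p](subrK (w n)) (le_trans (modulusD _ _))// lerD.
exists p => //; apply/eqP; rewrite -subr_eq0; apply/eqP/Normc.eq0_normc.
apply/eqP; rewrite eq_le modulus_ge0 andbT; apply: (small (d *+ 4)) => n.
rewrite (le_trans (modulus_triangle (w n.+1) _ _))//.
rewrite [modulus (w _ - p)]modulus_distC.
have := lerD (Plip p (w n) pd (wd n)) (pw n.+1).
have := pw n; rewrite exprS invfM mulrCA; set q := _ / 2 ^+ n.
rewrite /w /= -/(w n); lra.
Qed.

End ContractionPrinciple.

(** * The complex exponential *)

Section ComplexExponential.
Context {R : realType}.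
Implicit Types (z w : R[i]) (x y : R).

Definition cexp z : R[i] :=
  (expR (complex.Re z) * cos (complex.Im z)) +i*
  (expR (complex.Re z) * sin (complex.Im z)).

Lemma cexpD z w : cexp (z + w) = cexp z * cexp w.
Proof.
apply/eqP; rewrite eq_complex /cexp/= ReD ImD expRD cosD sinD.
by apply/andP; split; apply/eqP; ring.
Qed.

Lemma cexp0 : cexp 0 = 1.
Proof. by rewrite /cexp/= expR0 cos0 sin0 mul1r mulr0. Qed.

Lemma modulus_cexp z : modulus (cexp z) = expR (complex.Re z).
Proof.
rewrite /= !exprMn -mulrDr cos2Dsin2 mulr1 sqrtr_sqr ger0_norm// expR_ge0.
Qed.

Lemma cexpN z : cexp (- z) = (cexp z)^-1.
Proof.
have e : cexp (- z) * cexp z = 1 by rewrite -cexpD addNr cexp0.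
rewrite -[RHS]mul1r -e mulfK//; apply/eqP => z0.
by move/eqP: e; rewrite z0 mulr0 eq_sym oner_eq0.
Qed.

(** The principal logarithm on the right half plane. *)
Lemma cexp_onto w : 0 < complex.Re w -> exists2 z, cexp z = w &
  [/\ complex.Re z = ln (modulus w), - (pi / 2) < complex.Im z
    & complex.Im z < pi / 2].
Proof.
case: w => a b /= a0; set r := Num.sqrt _.
have r0 : 0 < r by rewrite sqrtr_gt0 ltr_wpDr ?sqr_ge0// exprn_gt0.
exists (ln r +i* atan (b / a)); last first.
  by split => //=; [exact: atan_gtNpi2|exact: atan_ltpi2].
have rE : r = a * Num.sqrt (1 + (b / a) ^+ 2).
  rewrite -[X in X * _](ger0_norm (ltW a0)) -sqrtr_sqr -sqrtrM ?sqr_ge0//.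
  by congr Num.sqrt; field; rewrite gt_eqF.
have s0 : Num.sqrt (1 + (b / a) ^+ 2) != 0.
  by rewrite gt_eqF// sqrtr_gt0 ltr_pwDl// sqr_ge0.
have c : cos (atan (b / a)) != 0.
  by rewrite cos_atan invr_eq0.
rewrite /cexp/= lnK//.
have -> : sin (atan (b / a)) = cos (atan (b / a)) * (b / a).
  by have := atanK (b / a); rewrite /tan => t;
    rewrite -[X in _ = _ * X]t [RHS]mulrC divfK.
by rewrite cos_atan rE; apply/eqP; rewrite eq_complex/=; apply/andP; split;
  apply/eqP; field; rewrite ?s0 ?gt_eqF.
Qed.

Lemma sin_le x : `|sin x| <= `|x|.
Proof.
wlog x0 : x / 0 < x.
  move=> H; have [/H//|x0|<-] := ltgtP 0 x; last by rewrite sin0.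
  by rewrite -normrN -sinN -[leRHS]normrN; apply: H; rewrite oppr_gt0.
have [|c _] := @MVT R sin cos 0 x x0 (fun=> fun=> is_derive_sin _).
  by apply/continuous_subspaceT => y; exact: continuous_sin.
rewrite sin0 !subr0 => ->; rewrite normrM ler_piMl//; exact: cos_max.
Qed.

Lemma cos_sub1_le x : `|cos x - 1| <= x ^+ 2 / 2.
Proof.
have -> : cos x - 1 = - (sin (x / 2) ^+ 2 *+ 2).
  by rewrite {1}[x]splitr -mulr2n cos_mulr2n cos2sin2; ring.
rewrite normrN ger0_norm ?mulrn_wge0 ?sqr_ge0//.
have -> : x ^+ 2 / 2 = (x / 2) ^+ 2 *+ 2 by field.
rewrite lerMn2r/= -[leLHS]real_normK ?num_real//.
by rewrite -[leRHS]real_normK ?num_real// lerXn2r ?nnegrE// sin_le.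
Qed.

Lemma sin_sub_le x : `|x| <= 1 -> `|sin x - x| <= x ^+ 2 / 2.
Proof.
wlog x0 : x / 0 < x.
  move=> H; have [/H//|x0|<-] := ltgtP 0 x;
    last by rewrite sin0 subr0 expr0n mul0r normr0.
  by have := H (- x); rewrite oppr_gt0 sinN -opprD !normrN sqrrN; apply.
rewrite gtr0_norm// => x1.
have [|c] := @MVT R sin cos 0 x x0 (fun=> fun=> is_derive_sin _).
  by apply/continuous_subspaceT => y; exact: continuous_sin.
rewrite in_itv/= => /andP[c0 cx]; rewrite sin0 !subr0 => ->.
rewrite -{2}[x]mul1r -mulrBl normrM (gtr0_norm x0).
rewrite (le_trans (ler_wpM2r (ltW x0) (cos_sub1_le c)))//.
have : c ^+ 2 <= x ^+ 2 by nra.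
have : x ^+ 2 <= x by nra.
nra.
Qed.

Lemma expR_sub1_le x : `|x| <= 1 / 2 -> 0 <= expR x - 1 - x <= 2 * x ^+ 2.
Proof.
rewrite ler_norml => /andP[x1 x2].
have h1 := expR_ge1Dx x; have := expR_ge1Dx (- x); rewrite expRN.
have e0 := expR_gt0 x.
move=> h2.
have := ler_wpM2l (ltW e0) h2; rewrite divff ?gt_eqF// => h3.
apply/andP; split; first lra.
nra.
Qed.

(** Second order control of the exponential at 0 gives its differentiability,
    the superattraction of 0 under Newton's map and the Lipschitz estimate
    behind local openness. *)
Lemma cexp_sub1_le w : modulus w <= 1 / 2 ->
  modulus (cexp w - 1 - w) <= 3 * modulus w ^+ 2.
Proof.
move=> w1; rewrite modulus_sqr (le_trans (modulus_le _))//.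
have := le_trans (modulus_Re w) w1; have := le_trans (modulus_Im w) w1.
case: w {w1} => x y /= y1 x1; rewrite subr0.
have /andP[e1 e2] := expR_sub1_le x1.
have := cos_sub1_le y.
have /sin_sub_le : `|y| <= 1 by rewrite (le_trans y1)//; lra.
move: x1 y1; rewrite !ler_norml.
set e := expR x in e1 e2 *; set c := cos y; set s := sin y.
move=> /andP[x1 x2] /andP[y1 y2] /andP[s1 s2] /andP[c1 c2].
have e_le2 : e <= 2 by nra.
have e_ge0 : 0 <= e by exact: expR_ge0.
have re : `|e * c - 1 - x| <= 2 * x ^+ 2 + y ^+ 2.
  have : e * (c - 1) <= 2 * (y ^+ 2 / 2) by nra.
  have : - (2 * (y ^+ 2 / 2)) <= e * (c - 1) by nra.
  by rewrite ler_norml => *; apply/andP; split; lra.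
have im : `|e * s - y| <= x ^+ 2 + 2 * y ^+ 2.
  have : e * (s - y) <= 2 * (y ^+ 2 / 2) by nra.
  have : - (2 * (y ^+ 2 / 2)) <= e * (s - y) by nra.
  have e1_le : `|e - 1| <= 2 * `|x|.
    have [x0|x0] := ger0P x; rewrite ler_norml; apply/andP; split; nra.
  have : `|(e - 1) * y| <= x ^+ 2 + y ^+ 2.
    rewrite normrM -(real_normK (num_real x)) -(real_normK (num_real y)).
    have := ler_wpM2r (normr_ge0 y) e1_le.
    have := sqr_ge0 (`|x| - `|y|); nra.
  rewrite !ler_norml => /andP[? ?] ? ?; apply/andP; split; lra.
lra.
Qed.

Lemma cexp_sub1_le_lin w : modulus w <= 1 / 2 ->
  modulus (cexp w - 1) <= 5 / 2 * modulus w.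
Proof.
move=> w1; rewrite -[cexp w - 1](subrK w) (le_trans (modulusD _ _))//.
have := cexp_sub1_le w1; have := modulus_ge0 w; nra.
Qed.

End ComplexExponential.

(** * Newton's map of the exponential minus one *)

Section Newton.
Context {R : realType}.
Implicit Types (z w c : R[i]) (d : R).

(** One step of Newton's method for e^z - 1. *)
Definition newton z : R[i] := z - 1 + cexp (- z).

Lemma newtonD z w :
  newton (z + w) = newton z + (w + cexp (- z) * (cexp (- w) - 1)).
Proof. by rewrite /newton opprD cexpD; ring. Qed.

Lemma newton_period z c : cexp c = 1 -> newton (z + c) = newton z + c.
Proof. by move=> c1; rewrite newtonD (cexpN c) c1 invr1 subrr mulr0 addr0. Qed.

Lemma iter_newton_period n z c :
  cexp c = 1 -> iter n newton (z + c) = iter n newton z + c.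
Proof. by move=> c1; elim: n => //= n ->; rewrite newton_period. Qed.

Lemma newton0 : newton 0 = 0.
Proof. by rewrite /newton oppr0 cexp0 sub0r addNr. Qed.

(** The constant 1 / 6 comes from 3 |z|^2 <= |z| / 2. *)
Lemma newton_near0 z :
  modulus z <= 1 / 6 -> modulus (newton z) <= modulus z / 2.
Proof.
move=> z6; have := @cexp_sub1_le R (- z); rewrite normcN.
have -> : cexp (- z) - 1 - - z = newton z by rewrite /newton; ring.
have := modulus_ge0 z; move=> z0 /(_ _)/le_trans; apply; [lra|nra].
Qed.

Lemma iter_newton_near0 n z :
  modulus z <= 1 / 6 -> modulus (iter n newton z) <= modulus z / 2 ^+ n.
Proof.
move=> z6; elim: n => [|n IH]; first by rewrite expr0 divr1.
have z0 := modulus_ge0 z.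
have p1 : modulus z / 2 ^+ n <= modulus z.
  by rewrite ler_pdivrMr ?exprn_gt0// ler_peMr// exprn_ege1// ler1n.
have /newton_near0/le_trans : modulus (iter n newton z) <= 1 / 6 by lra.
by rewrite iterS; apply; rewrite exprSr invfM mulrA ler_pM2r.
Qed.

(** By [newtonD], cexp (- z) - 1 + z is what remains of an increment of
    [newton] after its linear part is removed.  It is a strong contraction near
    0; with t = z - w, its increment is its value at t plus a product of two
    factors of orders w and t. *)
Lemma newton_remainder_lipschitz d z w : d <= 1 / 4 ->
    modulus z <= d -> modulus w <= d ->
  modulus ((cexp (- z) - 1 + z) - (cexp (- w) - 1 + w)) <=
    13 * d * modulus (z - w).
Proof.
move=> d4 zd wd; pose t := z - w.
have -> : (cexp (- z) - 1 + z) - (cexp (- w) - 1 + w) =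
    (cexp (- t) - 1 - (- t)) + (cexp (- w) - 1) * (cexp (- t) - 1).
  have -> : cexp (- z) = cexp (- w) * cexp (- t).
    by rewrite -cexpD; congr cexp; rewrite /t; ring.
  by rewrite /t; ring.
have td : modulus t <= 2 * d by rewrite (le_trans (modulusB _ _))//; lra.
have nt : modulus (- t) = modulus t by rewrite normcN.
have nw : modulus (- w) = modulus w by rewrite normcN.
have h1 : modulus (cexp (- t) - 1 - (- t)) <= 3 * modulus t ^+ 2.
  by rewrite -nt cexp_sub1_le// nt; lra.
have h2 : modulus (cexp (- t) - 1) <= 5 / 2 * modulus t.
  by rewrite -nt cexp_sub1_le_lin// nt; lra.
have h3 : modulus (cexp (- w) - 1) <= 5 / 2 * modulus w.
  by rewrite -nw cexp_sub1_le_lin// nw; lra.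
rewrite (le_trans (modulusD _ _))// Normc.normcM -/t.
have t0 := modulus_ge0 t; have w0 := modulus_ge0 w.
have := ler_pM (modulus_ge0 _) (modulus_ge0 _) h3 h2.
set u := modulus (cexp (- w) - 1) * _; set m := modulus t in td h1 h2 t0 *.
have : m * m <= 2 * d * m by nra.
have : modulus w * m <= d * m by nra.
rewrite expr2 in h1; nra.
Qed.

(** A quantitative inverse function theorem, where 1 - a is the derivative at
    z: solving newton (z + p) = w is a fixed point problem for the map P below,
    which halves distances by the bound on d. *)
Lemma newton_covers_disc d z (a := cexp (- z)) w : 0 <= d -> d <= 1 / 4 ->
    a != 1 -> 26 * d * modulus a <= modulus (1 - a) ->
    modulus (w - newton z) <= d * modulus (1 - a) / 2 ->
  exists2 z', modulus (z' - z) <= d & newton z' = w.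
Proof.
move=> d0 d4 a1 da wz; set b := modulus (1 - a) in da wz.
have na1 : 1 - a != 0 by rewrite subr_eq0 eq_sym.
have b0 : 0 < b.
  by rewrite lt_def modulus_ge0 andbT;
    apply: contra na1 => /eqP/Normc.eq0_normc ->.
pose E u : R[i] := cexp (- u) - 1 + u.
pose P u := ((w - newton z) - a * E u) / (1 - a).
have EL u v : modulus u <= d -> modulus v <= d ->
    modulus a * modulus (E u - E v) <= b * (modulus (u - v) / 2).
  move=> ud vd.
  have := ler_wpM2l (modulus_ge0 a) (newton_remainder_lipschitz d4 ud vd).
  move=> /le_trans; apply; have := modulus_ge0 (u - v); nra.
have [u vd|u v ud vd|p pd Pp] := @fixed_point_disc R P d d0.
- rewrite Normc.normcM Normc.normcV -/b ler_pdivrMr//.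
  rewrite (le_trans (modulusB _ _))// Normc.normcM.
  have := EL u 0 vd; rewrite Normc.normc0 => /(_ d0).
  rewrite [E 0]/E !(oppr0, cexp0, subrr, addr0).
  have : b * (modulus u / 2) <= b * (d / 2) by rewrite ler_pM2l//; lra.
  lra.
- have -> : P u - P v = - (a * (E u - E v)) / (1 - a) by rewrite /P; field.
  rewrite Normc.normcM normcN Normc.normcM Normc.normcV -/b ler_pdivrMr//.
  by rewrite [leRHS]mulrC EL.
exists (z + p); first by rewrite addrC addKr.
have : (1 - a) * p = w - newton z - a * E p.
  by rewrite -{1}Pp /P mulrC divfK.
rewrite newtonD -/a /E => e.
rewrite -[w](subrK (newton z)) -[w - _](subrK (a * (cexp (- p) - 1 + p))) -e.
ring.
Qed.

Lemma continuous_newton : continuous (newton : R[i]^o -> R[i]^o).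
Proof.
move=> z; apply: continuous_modulus => e e0.
set A := modulus (cexp (- z)); have A0 : 0 <= A by exact: modulus_ge0.
have K0 : 0 < 1 + A * (5 / 2) by nra.
exists (Num.min (1 / 2) (e / (1 + A * (5 / 2)))).
  by rewrite lt_min !divr_gt0.
move=> w; rewrite lt_min => /andP[w2]; rewrite ltr_pdivlMr// => we.
rewrite -[w in newton w](subrKC z) newtonD [newton z + _]addrC addrK.
rewrite (le_lt_trans (modulusD _ _))// Normc.normcM -/A.
have := @cexp_sub1_le_lin R (- (w - z)); rewrite normcN => /(_ (ltW w2)).
move=> /(ler_wpM2l A0); lra.
Qed.

Lemma newton_entire : entire (newton : R[i]^o -> R[i]^o).
Proof.
move=> z; apply/cvg_ex; exists (1 - cexp (- z)).
apply/cvgrPdist_lt => e e0.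
have eE : e = (complex.Re e)%:C by rewrite RRe_real// gtr0_real.
have e1 : 0 < complex.Re e by move: e0; rewrite eE ltcR.
set A := modulus (cexp (- z)); have A0 : 0 <= A by exact: modulus_ge0.
have K0 : 0 < 1 + A * 3 by nra.
apply/nbhs_modulus; exists (Num.min (1 / 2) (complex.Re e / (1 + A * 3))).
  by rewrite lt_min !divr_gt0.
move=> h; rewrite subr0 lt_min => /andP[h2]; rewrite ltr_pdivlMr// => he h0.
rewrite eE normE ltcR /= /shift/= -[h *: 1]/(h * 1) mulr1 -[_ *: _]/(_ * _).
rewrite [h + z]addrC newtonD [newton z + _]addrC addrK.
have -> : 1 - cexp (- z) - h^-1 * (h + cexp (- z) * (cexp (- h) - 1)) =
    - (cexp (- z) * (cexp (- h) - 1 - - h) / h) by field.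
have hp : 0 < modulus h.
  by rewrite lt_def modulus_ge0 andbT;
    apply: contra h0 => /eqP/Normc.eq0_normc ->.
rewrite normcN Normc.normcM Normc.normcV ltr_pdivrMr// Normc.normcM -/A.
have := @cexp_sub1_le R (- h); rewrite normcN => /(_ (ltW h2))/(ler_wpM2l A0).
move=> /le_lt_trans; apply.
have -> : A * (3 * modulus h ^+ 2) = modulus h * (A * 3) * modulus h by ring.
rewrite ltr_pM2r//; lra.
Qed.

End Newton.

(** * Generalities on Fatou sets *)

Section FatouSet.
Context {R : realType}.
Local Notation C := (R[i]^o).
Implicit Types (h : C -> C) (z : C) (V K : set C).

Lemma compact_nbhs z V :
  nbhs z V -> exists2 K, compact K & nbhs z K /\ K `<=` V.
Proof.
move=> /nbhs_modulus[r r0 rV].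
pose q (p : R * R) : C := z + (p.1 +i* p.2).
pose S : set (R * R) := `[- (r / 4), r / 4] `*` `[- (r / 4), r / 4].
have qV p : S p -> V (q p).
  case: p => a b [/=]; rewrite !in_itv/= -!ler_norml => ar br.
  apply: rV; rewrite /q addrC addKr (le_lt_trans (modulus_le _))//=; lra.
exists (q @` S); last split.
- apply: continuous_compact; last by apply: compact_setX;
    exact: segment_compact.
  apply: continuous_subspaceT => -[a b] A /nbhs_modulus[e e0 eA].
  exists (ball a (e / 2), ball b (e / 2)) => /=.
    by split; apply: nbhsx_ballx; rewrite divr_gt0.
  move=> [c d] [/= ac bd]; apply: eA.
  rewrite -ball_normE /= in ac bd.
  rewrite /q/= [z + (c +i* _)]addrC addrKA (le_lt_trans (modulus_le _))//=.
  by rewrite distrC [X in _ + X]distrC; lra.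
- apply/nbhs_modulus; exists (r / 4); first by rewrite divr_gt0.
  move=> w wz; exists (complex.Re (w - z), complex.Im (w - z)).
    split; rewrite /= in_itv/= -ler_norml ltW// (le_lt_trans _ wz)//.
      exact: modulus_Re.
    exact: modulus_Im.
  by rewrite /q/=; move: w z {wz rV q qV} => [? ?] [? ?]; apply/eqP;
    rewrite eq_complex/= !subrKC !eqxx.
- by move=> _ [p Sp <-]; exact: qV.
Qed.

Lemma family_cvg_modulus V (u : nat -> C -> C) (l : C -> C) :
  {family compactly_in V, u @ \oo --> l} <->
  forall K, K `<=` V -> compact K -> forall e : R, 0 < e ->
    \forall n \near \oo, forall z, K z -> modulus (u n z - l z) < e.
Proof.
split.
- move=> /fam_cvgP ul K KV cK e e0.
  apply: (ul K (conj KV cK) [set v | forall z, K z -> modulus (v z - l z) < e]).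
  apply/uniform_nbhs.
  exists [set p | ball p.1 e%:C p.2]; split.
    by rewrite -entourage_ballE; exists e%:C => //=; rewrite ltcR.
  move=> v vl z Kz; have := vl z Kz; rewrite -ball_normE /= distrC.
  by rewrite normE ltcR.
- move=> ul; apply/fam_cvgP => K [KV cK] A /uniform_nbhs[E [entE EA]].
  move: entE; rewrite -entourage_ballE => -[e /= e0 eE].
  have eR : e = (complex.Re e)%:C by rewrite RRe_real// gtr0_real.
  have e1 : 0 < complex.Re e by move: e0; rewrite eR ltcR.
  apply: filterS (ul K KV cK _ e1) => n un; apply: EA => z Kz; apply: eE => /=.
  by rewrite -ball_normE/= distrC eR normE ltcR; exact: un.
Qed.

(** Openness of h at the point z, kept local because the maps considered below
    are shown to be open at their noncritical points only. *)
Definition open_at h z := forall V, nbhs z V -> nbhs (h z) (h @` V).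

Lemma open_at_comp h k z : open_at h z -> open_at k (h z) -> open_at (k \o h) z.
Proof. by move=> oh ok V /oh/ok; rewrite image_comp. Qed.

Lemma open_at_iter h z n :
  (forall j, (j < n)%N -> open_at h (iter j h z)) -> open_at (iter n h) z.
Proof.
elim: n => [|n IH] oh; first by move=> V; rewrite /= image_id.
have -> : iter n.+1 h = h \o iter n h by [].
by apply: open_at_comp; [apply: IH => j jn; apply/oh/ltnW|exact: oh].
Qed.

(** A compact neighborhood K of z is mapped onto a neighborhood of h z.  With
    a (possibly discontinuous) section s of h over h(K), the iterate of order n
    on h(K) is the iterate of order n + 1 composed with s, and s takes its
    values in the single compact set K: this suffices for uniform statements. *)
Lemma Fatou_image h z : open_at h z -> Fatou h z -> Fatou h (h z).
Proof.
move=> oh [V [oV Vz] nV].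
have [K cK [Kz KV]] := compact_nbhs (open_nbhs_nbhs (conj oV Vz)).
have /choice[s sP] : forall y, exists x, (h @` K) y -> K x /\ h x = y.
  move=> y; have [[x Kx xy]|Ky] := pselect ((h @` K) y);
    last by exists y => /Ky.
  by exists x.
exists (interior (h @` K)); first split.
- exact: open_interior.
- exact: oh.
move=> u uF; have /choice[k uk] : forall n, exists k, iter k h = u n.
  by move=> n; have [k _ <-] := uF n; exists k.
have uS n y : (h @` K) y -> u n y = iter (k n).+1 h (s y).
  by move=> /sP[_ sy]; rewrite -uk iterSr sy.
have [|phi phi_lt limV] := nV (fun n => iter (k n).+1 h).
  by move=> n; exists (k n).+1.
exists phi => //; case: limV => [[l ul]|dV].
- left; exists (l \o s); apply/family_cvg_modulus => K' K'W cK' e e0.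
  move/family_cvg_modulus: ul => /(_ K KV cK e e0);
    apply: filterS => n un y K'y.
  have Ky := interior_subset (K'W _ K'y).
  by rewrite uS//; apply: un; have [] := sP y Ky.
- right=> K' M [K'W cK']; have := dV K M (conj KV cK).
  apply: filterS => n un y K'y; have Ky := interior_subset (K'W _ K'y).
  by rewrite uS//; apply: un; have [] := sP y Ky.
Qed.

Lemma continuous_iter h n : continuous h -> continuous (iter n h).
Proof.
move=> ch; elim: n => [|n IH] z; first exact: cvg_id.
by apply: continuous_comp; [exact: IH|exact: ch].
Qed.

Lemma image_component_iter h z k : continuous h ->
    (forall w, Fatou h w -> Fatou h (h w)) -> Fatou h z ->
  image_component h (connected_component (Fatou h) z) k
    (connected_component (Fatou h) (iter k h z)).
Proof.
move=> ch Fh Fz.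
have Fk j w : Fatou h w -> Fatou h (iter j h w) by elim: j => //= j IH /IH/Fh.
split; first by exists (iter k h z) => //; exact: Fk.
have ck := continuous_iter (n := k) ch.
apply: connected_component_max.
- by exists z => //; exact: connected_component_refl.
- by move=> _ [w /connected_component_sub Fw <-]; exact: Fk.
- apply: connected_continuous_connected; first exact: component_connected.
  exact: continuous_subspaceT.
Qed.

(** Unlike the balls of the normed module, discs have a real radius. *)
Definition disc (c : C) (r : R) : set C := [set z | modulus (z - c) < r].

Lemma disc_center (c : C) (r : R) : 0 < r -> disc c r c.
Proof. by move=> r0; rewrite /disc/= subrr [X in X < _]Normc.normc0. Qed.

Lemma disc_domain (c : C) (r : R) : 0 < r -> domain (disc c r).
Proof.
move=> r0; have cr := disc_center c r0; split; first by exists c.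
- rewrite openE => z zr; apply/nbhs_modulus; exists (r - modulus (z - c)).
    by rewrite subr_gt0.
  move=> w wz; rewrite /disc/= (le_lt_trans (modulus_triangle z _ _))//; lra.
- pose seg z := (fun t : R => (c + t%:C * (z - c) : C)) @` `[0, 1].
  have -> : disc c r = \bigcup_(z in disc c r) seg z.
    apply/seteqP; split => [z zr|_ [z zr [t tI <-]]].
      exists z => //; exists 1; rewrite /= ?in_itv/= ?ler01 ?lexx//.
      by rewrite mul1r subrKC.
    move: tI; rewrite /= in_itv/= => /andP[t0 t1].
    rewrite /disc/= addrAC subrr add0r Normc.normcM modulus_real ger0_norm//.
    by rewrite (le_lt_trans _ zr)// ler_piMl// modulus_ge0.
  apply: bigcup_connected.
    by exists c => z _; exists 0;
      rewrite /= ?in_itv/= ?lexx ?ler01 ?mul0r ?addr0.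
  move=> z _; apply: connected_continuous_connected;
    first exact: segment_connected.
  apply: continuous_subspaceT => t A /nbhs_modulus[e e0 eA].
  have z1 : 0 < modulus (z - c) + 1 by rewrite ltr_wpDl// modulus_ge0.
  apply/nbhs_ballP; exists (e / (modulus (z - c) + 1)) => /=;
    first by rewrite divr_gt0.
  move=> s; rewrite -ball_normE/= ltr_pdivlMr// distrC => ts.
  apply: eA; rewrite opprD addrACA subrr add0r -mulrBl -raddfB/=.
  rewrite Normc.normcM modulus_real (le_lt_trans _ ts)// ler_wpM2l//; lra.
Qed.

End FatouSet.

Section NormalIterates.
Context {R : realType}.
Local Notation C := (R[i]^o).

Lemma subsequence_choice (P : nat -> nat -> Prop) :
    (forall j N, exists2 n, (N <= n)%N & P j n) ->
  exists2 phi : nat -> nat,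
    {homo phi : m n / (m < n)%N} & forall j, P j (phi j).
Proof.
move=> Pn; have /choice[F FP] : forall jN : nat * nat, exists n,
    (jN.2 <= n)%N /\ P jN.1 n by move=> [j N]; have [n ? ?] := Pn j N; exists n.
pose phi := fix phi j := if j is i.+1 then F (j, (phi i).+1) else F (0%N, 0%N).
exists phi; last by case=> [|j]; exact: (FP (_, _)).2.
by apply: homo_ltn => [|j]; [exact: ltn_trans|exact: (FP (_, _)).1].
Qed.

Lemma subsequence_constant_or_large (k : nat -> nat) :
  exists2 phi : nat -> nat, {homo phi : m n / (m < n)%N} &
    (exists m, forall n, k (phi n) = m) \/ (forall n, (n <= k (phi n))%N).
Proof.
have [[m km]|km] := pselect (exists m, forall N, exists2 n, (N <= n)%N &
  k n = m).
  have [phi ? ?] := @subsequence_choice (fun _ n => k n = m) (fun _ => km).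
  by exists phi => //; left; exists m.
have [|phi ? ?] := @subsequence_choice (fun j n => (j <= k n)%N); last first.
  by exists phi => //; right.
have big M : exists N, forall n, (N <= n)%N -> (M <= k n)%N.
  elim: M => [|M [N NM]]; first by exists 0%N.
  have /existsNP[N' NN'] : ~ forall N, exists2 n, (N <= n)%N & k n = M.
    by move=> kM; apply: km; exists M.
  exists (maxn N N') => n; rewrite geq_max => /andP[/NM Mk N'n].
  by rewrite ltn_neqAle Mk andbT; apply/eqP => kM; apply: NN'; exists n.
move=> j N; have [N' N'j] := big j.
by exists (maxn N N'); [exact: leq_maxl|apply: N'j; exact: leq_maxr].
Qed.

(** An arbitrary sequence of iterates has either a constant subsequence, which
    converges, or one whose orders tend to infinity, which inherits the
    behavior of the whole sequence of iterates. *)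
Lemma normal_family_iter (h : C -> C) (V : set C) :
    (exists l : C -> C,
       {family compactly_in V, (fun n => iter n h) @ \oo --> l}) \/
    diverges_compactly V (fun n => iter n h) ->
  normal_family V (range (fun n => iter n h)).
Proof.
move=> lim u uF; have /choice[k uk] : forall n, exists k, iter k h = u n.
  by move=> n; have [k _ <-] := uF n; exists k.
have [phi phi_lt kphi] := subsequence_constant_or_large k.
exists phi => //; case: kphi => [[m km]|kn].
  left; exists (iter m h); apply/family_cvg_modulus => K _ _ e e0.
  apply: nearW => n z _; rewrite -uk km subrr.
  by rewrite [X in X < _]Normc.normc0.
have far (P : nat -> Prop) : (\forall n \near \oo, P n) ->
    \forall n \near \oo, P (k (phi n)).
  by move=> [N _ NP]; exists N => // n /= Nn; apply: NP => /=;
    exact: leq_trans (kn n).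
case: lim => [[l hl]|dV]; [left; exists l|right].
  apply/family_cvg_modulus => K KV cK e e0.
  move/family_cvg_modulus: hl => /(_ K KV cK e e0)/far.
  by apply: filterS => n; rewrite uk.
by move=> K M KV; have /far := dV K M KV; apply: filterS => n; rewrite uk.
Qed.

End NormalIterates.

(** * Iterates of Newton's map composed with the translation by 2 pi i *)

Section Shift.
Context {R : realType}.
Local Notation C := (R[i]^o).
Implicit Types (z c s : C) (b n k : nat).

Definition tau : C := 0 +i* (pi *+ 2).

Lemma cexp_mulrn c n : cexp c = 1 -> cexp (c *+ n) = 1 :> R[i].
Proof.
by move=> c1; elim: n => [|n IH]; rewrite ?cexp0// mulrS cexpD c1 IH mulr1.
Qed.

Lemma cexp_tau : cexp tau = 1 :> R[i].
Proof. by rewrite /cexp/= expR0 cos2pi sin2pi mulr1 mulr0. Qed.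

Lemma Re_tau n : complex.Re (tau *+ n) = 0.
Proof. by elim: n => // n IH; rewrite mulrS ReD IH addr0. Qed.

Lemma Im_tau n : complex.Im (tau *+ n) = pi *+ n.*2.
Proof.
by elim: n => // n IH; rewrite mulrS ImD IH/= -mulrnDr add2n.
Qed.

Lemma modulus_tau n : modulus (tau *+ n) = pi *+ n.*2.
Proof.
have -> : tau *+ n = 0 +i* (pi *+ n.*2).
  by apply/eqP; rewrite eq_complex Re_tau Im_tau/= !eqxx.
by rewrite /= expr0n add0r sqrtr_sqr ger0_norm// mulrn_wge0// pi_ge0.
Qed.

(** With cexp s = 1 this family contains f (b = 1, s = 0), g (b = 1, s = tau)
    and both of their compositions (b = 2, s = tau). *)
Definition newton_shift b s z : C := iter b newton z + s.

Lemma iter_newton_shift b s n z : cexp s = 1 ->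
  iter n (newton_shift b s) z = iter (n * b) newton z + s *+ n.
Proof.
move=> s1; elim: n => [|n IH]; first by rewrite addr0.
rewrite iterS IH /newton_shift iter_newton_period; last exact: cexp_mulrn.
by rewrite -iterD -mulSn -addrA -mulrSr.
Qed.

Lemma continuous_newton_shift b s : continuous (newton_shift b s).
Proof.
have ci := continuous_iter (n := b) (@continuous_newton R).
have cs : continuous (fun w : C => w + s).
  move=> w; apply: continuous_modulus => e e0; exists e => // w' w'w.
  by rewrite opprD addrACA subrr addr0.
by move=> z; exact: (continuous_comp (ci z) (cs _)).
Qed.

Lemma newton_open_at z : cexp (- z) != 1 -> open_at (newton : C -> C) z.
Proof.
move=> z1 V /nbhs_modulus[r r0 rV].
set a := cexp (- z) in z1; have na1 : 0 < modulus (1 - a).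
  rewrite lt_def modulus_ge0 andbT; apply: contra z1.
  by move=> /eqP/Normc.eq0_normc/eqP; rewrite subr_eq0 eq_sym.
have a0 := modulus_ge0 a.
pose k := 26 * (modulus a + 1); have k0 : 0 < k by rewrite /k; lra.
pose d := Num.min (r / 2) (Num.min (1 / 4) (modulus (1 - a) / k)).
have d0 : 0 < d by rewrite /d !lt_min !divr_gt0.
apply/nbhs_modulus; exists (d * modulus (1 - a) / 2).
  by rewrite divr_gt0// mulr_gt0.
move=> w wz; have [|//|||z' z'z <-] := @newton_covers_disc R d z w (ltW d0).
- by rewrite /d !ge_min lexx orbT.
- have : d <= modulus (1 - a) / k by rewrite /d !ge_min lexx !orbT.
  by rewrite ler_pdivlMr// /k -/a; nra.
- exact: ltW.
exists z' => //; apply: rV; rewrite (le_lt_trans z'z)//.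
have : d <= r / 2 by rewrite /d ge_min lexx.
lra.
Qed.

(** If the orbit of z under [newton] meets a critical point before time b, this
    point is fixed, hence the image of z is again of the form c with cexp c = 1.
    Otherwise the map is open at z. *)
Lemma newton_shift_image b s z : cexp s = 1 ->
    (forall c, cexp c = 1 -> Fatou (newton_shift b s) c) ->
  Fatou (newton_shift b s) z -> Fatou (newton_shift b s) (newton_shift b s z).
Proof.
move=> s1 cF zF.
have [[j jb jz]|noncrit] :=
  pselect (exists2 j, (j < b)%N & cexp (- iter j newton z) = 1).
  set c := iter j newton z in jz; have c1 : cexp c = 1.
    by rewrite -[c]opprK cexpN jz invr1.
  have fixc n : iter n newton c = c.
    elim: n => //= n ->.
    by rewrite -[c in newton c]add0r newton_period// newton0 add0r.
  apply: cF; rewrite /newton_shift cexpD s1 mulr1 -(subnK (ltnW jb)) iterD.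
  by rewrite -/c fixc.
apply: Fatou_image zF.
have -> : newton_shift b s = (fun w => w + s) \o iter b newton by [].
apply: open_at_comp.
  apply: open_at_iter => j jb; apply: newton_open_at.
  by apply/eqP => jz; apply: noncrit; exists j.
move=> V /nbhs_modulus[r r0 rV]; apply/nbhs_modulus; exists r => // w wr.
exists (w - s); last by rewrite subrK.
by apply: rV; rewrite -addrA -opprD [s + _]addrC.
Qed.

Lemma newton_disc_converges c n z : cexp c = 1 -> modulus (z - c) < 1 / 6 ->
  modulus (iter n newton z - c) <= 1 / 6 / 2 ^+ n.
Proof.
move=> c1 zc; rewrite -[z](subrK c) iter_newton_period// addrK.
rewrite (le_trans (iter_newton_near0 n (ltW zc)))// ler_pM2r ?ltW//.
Qed.

Lemma newton_disc_normal c : cexp c = 1 ->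
  normal_family (disc c (1 / 6))
    (range (fun n => iter n (newton_shift 1 0))).
Proof.
move=> c1; apply: normal_family_iter; left; exists (fun=> c).
apply/family_cvg_modulus => K KV _ e e0.
have [N Ne] := small_div_exp2 (1 / 6) e0; exists N => // n /= Nn z /KV/= zc.
rewrite iter_newton_shift ?cexp0// mul0rn addr0 muln1.
exact: le_lt_trans (newton_disc_converges n c1 zc) (Ne n Nn).
Qed.

Lemma newton_shift_disc_normal b c : cexp c = 1 ->
  normal_family (disc c (1 / 6))
    (range (fun n => iter n (newton_shift b tau))).
Proof.
move=> c1; apply: normal_family_iter; right => K M [KV _].
exists (Num.bound (`|M| + modulus c + 1)) => // n /= Nn z /KV/= zc.
rewrite iter_newton_shift ?cexp_tau// normE ltcR.
have := newton_disc_converges (n * b) c1 zc.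
have p1 : 1 / 6 / 2 ^+ (n * b) <= 1 / 6 :> R.
  by rewrite ler_pdivrMr ?exprn_gt0// ler_peMr// ?exprn_ege1 ?ler1n//; lra.
set w := iter _ _ _ => wc.
have : `|M| + modulus c + 1 < n%:R.
  have := archi_boundP (_ : 0 <= `|M| + modulus c + 1).
  have := modulus_ge0 c; have := normr_ge0 M.
  move=> M0 c0 /(_ _)/lt_le_trans; apply; first lra.
  by rewrite ler_nat.
have : n%:R <= modulus (tau *+ n).
  rewrite modulus_tau -mul2n mulrnA lerMn2r; apply/orP; right.
  by rewrite mulr2n; have := pi_ge2 R; lra.
set T := tau *+ n; have TE : (w + T) - (w - c) - c = T by ring.
have := modulusB (w + T - (w - c)) c; rewrite TE;
  have := modulusB (w + T) (w - c).
have := ler_norm M.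
lra.
Qed.

End Shift.

(** * Dynamics on the odd horizontal lines and in the right half plane *)

Section Barrier.
Context {R : realType}.
Local Notation C := (R[i]^o).
Implicit Types (z w u : C) (b k n N : nat).

Definition odd_line k : set C := [set z | complex.Im z = pi *+ k.*2.+1].

Lemma cexp_odd_line k z : odd_line k z ->
  cexp (- z) = (- expR (- complex.Re z))%:C.
Proof.
move=> zk; rewrite /cexp ReN ImN zk cosN sinN mulrSr -mul2n mulrnA.
have c1 : cos (pi *+ 2 *+ k) = 1 :> R.
  by rewrite -[_ *+ k]add0r (periodicn (@cosD2pi R)) cos0.
have s0 : sin (pi *+ 2 *+ k) = 0 :> R.
  by rewrite -[_ *+ k]add0r (periodicn (@sinD2pi R)) sin0.
by rewrite cosDpi sinDpi c1 s0 !oppr0 mulr0 mulrN1.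
Qed.

Lemma newton_odd_line k z : odd_line k z -> odd_line k (newton z) /\
  complex.Re (newton z) = complex.Re z - 1 - expR (- complex.Re z).
Proof.
move=> zk; rewrite /odd_line/= /newton (cexp_odd_line zk) !ReD !ImD ReN ImN/=.
by rewrite zk oppr0 !addr0.
Qed.

Lemma iter_newton_odd_line k n z : odd_line k z ->
  odd_line k (iter n newton z) /\
  complex.Re (iter n newton z) <= complex.Re z - n%:R.
Proof.
move=> zk; elim: n => [|n [IHk IH]]; first by rewrite subr0.
rewrite iterS; have [? ->] := newton_odd_line IHk; split => //.
by rewrite mulrSr; have := expR_gt0 (- complex.Re (iter n newton z)); lra.
Qed.

(** Far to the left on an odd line the derivative 1 + E of [newton] exceeds 520,
    so the covering lemma applies with the small radius d = 2 r / (1 + E); its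
    hypothesis follows from 52 r <= 520 <= E. *)
Lemma pullback_step k z w (r : R) : odd_line k z -> complex.Re z <= - 520 ->
    r <= 10 -> modulus (w - newton z) <= r ->
  exists2 z', modulus (z' - z) <= r / 2 & newton z' = w.
Proof.
move=> zk z520 r10 wr; have r0 : 0 <= r by exact: le_trans (modulus_ge0 _) wr.
set E := expR (- complex.Re z).
have E521 : 521 <= E by have := expR_ge1Dx (- complex.Re z); rewrite -/E; lra.
have aE : cexp (- z) = (- E)%:C by exact: cexp_odd_line zk.
have ma : modulus (cexp (- z)) = E by rewrite modulus_cexp ReN.
have m1a : modulus (1 - cexp (- z)) = 1 + E.
  have -> : 1 - cexp (- z) = (1 + E)%:C.
    by rewrite aE; apply/eqP; rewrite eq_complex/= opprK oppr0 addr0 !eqxx.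
  by rewrite modulus_real ger0_norm//; lra.
have E0 : 0 < 1 + E by lra.
pose d := 2 * r / (1 + E).
have dE : d * (1 + E) = 2 * r by rewrite /d divfK// gt_eqF.
have d0 : 0 <= d by rewrite /d divr_ge0; lra.
have [||||z' z'z z'w] := @newton_covers_disc R d z w d0.
- nra.
- apply/eqP => a1; move: m1a; rewrite a1 subrr [X in X = _]Normc.normc0; lra.
- rewrite ma m1a; nra.
- by rewrite m1a dE; lra.
by exists z' => //; rewrite (le_trans z'z)//; nra.
Qed.

Lemma pullback k n z w : odd_line k z -> complex.Re z <= - 520 ->
    modulus (w - iter n newton z) <= 10 ->
  exists2 z', modulus (z' - z) <= 10 / 2 ^+ n & iter n newton z' = w.
Proof.
elim: n z w => [|n IH] z w zk z520 wz.
  by exists w => //; rewrite expr0 divr1.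
have [fzk fzE] := newton_odd_line zk.
have fz520 : complex.Re (newton z) <= - 520.
  by rewrite fzE; have := expR_gt0 (- complex.Re z); lra.
rewrite iterSr in wz; have [w' w'z w'w] := IH _ _ fzk fz520 wz.
have [|z' z'z z'w] := pullback_step zk z520 _ w'z.
  by rewrite ler_pdivrMr ?exprn_gt0// ler_peMr// exprn_ege1// ler1n.
exists z'; first by rewrite exprSr invfM mulrA.
by rewrite iterSr z'w.
Qed.

(** A step subtracts 1 up to an error e^{-Re}.  As the real part decreases by
    about 1 per step and e >= 2, these errors grow at least like powers of 2,
    so their sum is controlled by the bound on the last one. *)
Lemma newton_right u (M j : nat) : (j <= M)%N -> M%:R + 1 <= complex.Re u ->
  modulus (iter j newton u - (u - j%:R)) <= 2 ^+ j / 2 ^+ M.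
Proof.
move=> + uM; elim: j => [|j IH] jM.
  by rewrite subr0 subrr [leLHS]Normc.normc0 divr_ge0.
have {}IH := IH (ltnW jM); set v := iter j newton u in IH *.
have p1 : 2 ^+ j / 2 ^+ M <= 1 :> R.
  by rewrite ler_pdivrMr ?exprn_gt0// mul1r ler_weXn2l ?ler1n// ltnW.
have Rev : M%:R - j%:R <= complex.Re v.
  have := le_trans (modulus_Re _) (le_trans IH p1).
  rewrite ler_norml !(ReD, ReN).
  rewrite Re_nat.
  move=> /andP[]; lra.
have ev : modulus (cexp (- v)) <= 2 ^+ j / 2 ^+ M.
  have -> : 2 ^+ j / 2 ^+ M = (2 ^+ (M - j))^-1 :> R.
    rewrite -(subnK (ltnW jM)) exprD invfM mulrCA divff ?expf_neq0// mulr1.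
    by rewrite addnK.
  rewrite modulus_cexp ReN expRN lef_pV2 ?posrE ?expR_gt0 ?exprn_gt0//.
  apply: (@le_trans _ _ (expR (M - j)%:R));
    last by rewrite ler_expR natrB// ltnW.
  rewrite -[(M - j)%:R]mulr1 expRM_natl lerXn2r ?nnegrE ?expR_ge0//.
  by have := expR_ge1Dx (1 : R); lra.
have -> : iter j.+1 newton u - (u - j.+1%:R) = (v - (u - j%:R)) + cexp (- v).
  by rewrite iterS -/v /newton mulrSr; ring.
rewrite (le_trans (modulusD _ _))//; rewrite exprS; lra.
Qed.

End Barrier.

(** * The odd horizontal lines lie outside of the Fatou set *)

Section BarrierInJulia.
Context {R : realType}.
Local Notation C := (R[i]^o).
Implicit Types (z w u : C) (b k n N : nat).

(** The n-th iterate of h = newton^b + tau is newton^(n b) + n tau.  With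
    n b = N + 1 + m, the point p is found by pulling back, along the first N
    steps from z, a point v near zeta = newton^N z for which newton v is within
    distance 10 of m + 11 - n tau; the last m steps are nearly translations
    by -1 and lead back to a bounded distance from - n tau. *)
Lemma bounded_return b k z N : (0 < b <= 2)%N -> (k <= N)%N ->
    odd_line k z -> complex.Re z <= - 520 ->
  exists n p, [/\ (N <= n)%N, modulus (p - z) <= 10 / 2 ^+ N
    & modulus (iter n (newton_shift b tau) p) <= 22].
Proof.
move=> /andP[b0 b2] kN zk z520; set zeta := iter N newton z.
have [zetak zetaN] := iter_newton_odd_line N zk.
rewrite -/zeta in zetak zetaN; set y := - complex.Re zeta.
have yN : 520 + N%:R <= y by rewrite /y; lra.
have N0 : 0 <= N%:R :> R by [].
have kN' : k%:R <= N%:R :> R by rewrite ler_nat.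
set E := expR y.
have E_ge : 1 + y ^+ 2 / 2 <= E.
  by have := @expR_ge1Dxn R y 1; apply; lra.
have E0 : 0 < E by exact: expR_gt0.
have /andP[tE Et] := truncn_itv (ltW E0); set T := Num.truncn E in tE Et.
(* The number of remaining steps has to be comparable to |om|, which in turn
   has to be comparable to E = |cexp (- zeta)| for v to be close to zeta. *)
pose n := (T + N.+1)%N; pose m := (n * b - N.+1)%N.
have nb : (n <= n * b)%N by rewrite leq_pmulr.
have mN : (m + N.+1 = n * b)%N by rewrite subnK// (leq_trans _ nb)// leq_addl.
have mT : (T <= m)%N by rewrite -(leq_add2r N.+1) mN.
have m2n : (m <= 2 * n)%N.
  by rewrite (leq_trans (leq_subr _ _))// mulnC leq_mul2r b2 orbT.
have mT' : T%:R <= m%:R :> R by rewrite ler_nat.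
have m2n' : m%:R <= 2 * n%:R :> R by rewrite -natrM ler_nat.
have nE : n%:R = T%:R + N%:R + 1 :> R by rewrite natrD -addn1 natrD addrA.
have TS : T.+1%:R = T%:R + 1 :> R by rewrite -addn1 natrD.
rewrite TS in Et.
(* newton v = v - 1 + om if cexp (- v) = om: the definition of om makes
   newton v equal to (v - zeta) + (m + 11) - n tau. *)
pose om : C := m%:R + 12%:R - tau *+ n - zeta.
have Reom : complex.Re om = m%:R + 12 + y.
  by rewrite /om !(Re_nat, ReD, ReN) Re_tau oppr0 addr0.
have Imom : complex.Im om = - (pi *+ n.*2 + pi *+ k.*2.+1).
  by rewrite /om !(Im_nat, ImD, ImN) Im_tau zetak addr0 add0r opprD.
have om_lo : E <= modulus om.
  have := le_trans (ler_norm _) (modulus_Re om); rewrite Reom; lra.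
have om0 : 0 < modulus om by lra.
have pi4 : pi <= 4 :> R by have := pihalf_lt2 R; lra.
have pi0 := pi_ge0 R.
have om_hi : modulus om <= 16 * E.
  rewrite (le_trans (modulus_le _))// Reom Imom normrN -[pi *+ _ + _]mulrnDr.
  rewrite [X in X + _]ger0_norm; last by lra.
  rewrite [X in _ + X]ger0_norm ?(mulrn_wge0 _ pi0)// -(mulr_natr pi).
  have -> : (n.*2 + k.*2.+1)%:R = 2 * n%:R + 2 * k%:R + 1 :> R.
    by rewrite addnS mulrSr natrD -!mul2n !natrM.
  nra.
have [l lom [Rel Iml1 Iml2]] : exists2 l, cexp l = om &
  [/\ complex.Re l = ln (modulus om), - (pi / 2) < complex.Im l
    & complex.Im l < pi / 2] by apply: cexp_onto; rewrite Reom; lra.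
have Rel1 : y <= complex.Re l.
  by rewrite Rel -[y]expRK ler_ln ?posrE.
have Rel2 : complex.Re l <= y + 4.
  rewrite Rel -[y + 4]expRK ler_ln ?posrE ?expR_gt0// expRD (le_trans om_hi)//.
  rewrite mulrC ler_pM2l// -[4]/(4%:R) -[4%:R]mulr1 expRM_natl.
  have := expR_ge1Dx (1 : R); set e := expR 1 => e2.
  have : 4 <= e ^+ 2 by nra.
  have -> : e ^+ 4 = (e ^+ 2) ^+ 2 by ring.
  nra.
(* The multiple of tau puts v within 3 pi / 2 of the height of zeta; the real
   parts differ by at most 4, whence the radius 10 of [pullback]. *)
pose v : C := - l + tau *+ k.
have cv : cexp (- v) = om.
  rewrite /v opprD opprK cexpD cexpN (cexp_mulrn _ cexp_tau) invr1.
  by rewrite mulr1.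
have vz : modulus (v - zeta) <= 10.
  rewrite (le_trans (modulus_le _))// /v !(ReD, ReN, ImD, ImN) Re_tau Im_tau
    zetak.
  rewrite addr0 -/y mulrSr.
  have -> : `|- complex.Re l + y| = complex.Re l - y.
    by rewrite ler0_norm ?opprD ?opprK//; lra.
  have -> : `|- complex.Im l + pi *+ k.*2 - (pi *+ k.*2 + pi)| =
     complex.Im l + pi.
    by rewrite -normrN ger0_norm; lra.
  lra.
have [p pz pv] := pullback zk z520 vz.
exists n, p; split => //;
  first by rewrite /n addnS (leq_trans (leq_addl T N))// leqnSn.
pose u := newton v.
have uE : u = (v - zeta) + (m%:R + 11%:R) - tau *+ n.
  by rewrite /u /newton cv /om; ring.
have Reu : m%:R + 1 <= complex.Re u.
  have := le_trans (modulus_Re _) vz; rewrite ler_norml => /andP[h _].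
  rewrite uE 2!ReD [complex.Re (m%:R + _)]ReD ReN Re_tau !Re_nat; lra.
have := newton_right (leqnn m) Reu; rewrite divff ?expf_neq0// => um.
rewrite iter_newton_shift ?cexp_tau// -mN addnS -addSn iterD pv iterSr -/u.
have -> : iter m newton u + tau *+ n =
    (iter m newton u - (u - m%:R)) + (v - zeta) + 11%:R.
  by rewrite uE; ring.
rewrite (le_trans (modulusD _ _))//.
have -> : modulus (11%:R : R[i]) = 11.
  by rewrite -(rmorph_nat (real_complex R)) modulus_real ger0_norm.
have := modulusD (iter m newton u - (u - m%:R)) (v - zeta); lra.
Qed.

Lemma leq_increasing (phi : nat -> nat) n :
  {homo phi : i j / (i < j)%N} -> (n <= phi n)%N.
Proof. by move=> ph; elim: n => // n IH;
  exact: leq_ltn_trans IH (ph _ _ _). Qed.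

(** For the iterates h^n given by [bounded_return] the orbit of z tends to
    infinity, which excludes convergence, while points arbitrarily close to z
    are mapped into a fixed disc, which excludes uniform divergence. *)
Lemma far_left_odd_line_Julia b k z : (0 < b <= 2)%N ->
  odd_line k z -> complex.Re z <= - 520 -> ~ Fatou (newton_shift b tau) z.
Proof.
move=> b02 zk z520 [V Vz nV]; set h := newton_shift b tau in nV *.
have /choice[np npP] : forall j, exists np : nat * C,
    [/\ (j <= np.1)%N, modulus (np.2 - z) <= 10 / 2 ^+ j
      & modulus (iter np.1 h np.2) <= 22].
  move=> j; have [n [p [jn pz hp]]] :=
    bounded_return b02 (leq_addr j k) zk z520.
  exists (n, p); split => //; first exact: leq_trans (leq_addl _ _) jn.
  rewrite (le_trans pz)// ler_pM2l// lef_pV2 ?posrE ?exprn_gt0//.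
  by rewrite ler_weXn2l ?ler1n// leq_addl.
have orbit_far n : n%:R <= modulus (iter n h z).
  rewrite (le_trans _ (modulus_Re _))// -normrN (le_trans _ (ler_norm _))//.
  rewrite iter_newton_shift ?cexp_tau// ReD Re_tau addr0.
  have [_] := iter_newton_odd_line (n * b) zk.
  have : n%:R <= (n * b)%:R :> R by rewrite ler_nat leq_pmulr//; case/andP: b02.
  lra.
have [|phi phi_lt lim] := nV (fun j => iter (np j).1 h); first by move=> j;
  exists (np j).1.
case: lim => [[l ul]|dV].
- move/family_cvg_modulus: ul => /(_ [set z] _ (@compact_set1 _ z) 1 ltr01).
  case=> [_ -> //|]; first exact: Vz.2.
  move=> N _ /= uN; pose j := maxn N (Num.bound (modulus (l z) + 1)).
  have := uN j (leq_maxl _ _) z erefl.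
  have : modulus (l z) + 1 < j%:R.
    have := archi_boundP (_ : 0 <= modulus (l z) + 1).
    have := modulus_ge0 (l z) => l0 /(_ _)/lt_le_trans; apply; first lra.
    by rewrite ler_nat leq_maxr.
  have : j%:R <= modulus (iter (np (phi j)).1 h z).
    rewrite (le_trans _ (orbit_far _))// ler_nat.
    by have [jn _ _] := npP (phi j); rewrite (leq_trans _ jn)// leq_increasing.
  set U := iter _ _ _.
  have := modulusD (U - l z) (l z); rewrite subrK; lra.
- have [K cK [Kz KV]] := compact_nbhs (open_nbhs_nbhs Vz).
  have [N _ /= far] := dV K 22 (conj KV cK).
  have /nbhs_modulus[r r0 rK] := Kz.
  have [N' N'r] := small_div_exp2 10 r0.
  pose j := maxn N N'; have [_ pz hp] := npP (phi j).
  have := far j (leq_maxl _ _) (np (phi j)).2;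
  rewrite normE ltcR ltNge hp => /(_ _)/negP; apply => //.
  apply: rK; rewrite (le_lt_trans pz)// N'r// (leq_trans (leq_maxr N N'))//.
  exact: leq_increasing.
Qed.

End BarrierInJulia.

(** * Fatou components around the fixed points *)

Section Main.
Context {R : realType}.
Local Notation C := (R[i]^o).
Implicit Types (z w u : C) (b k n N : nat).

Lemma Fatou_disc (h : C -> C) (c : C) (r : R) : 0 < r ->
  normal_family (disc c r) (range (fun n => iter n h)) -> disc c r `<=` Fatou h.
Proof.
move=> r0 nd z zr; exists (disc c r) => //; split => //.
by have [_ od _] := disc_domain c r0.
Qed.

Lemma Fatou_newton c :
  cexp c = 1 -> disc c (1 / 6) `<=` Fatou (newton_shift 1 0 : C -> C).
Proof. by move=> c1; apply: Fatou_disc; [lra|exact: newton_disc_normal]. Qed.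

Lemma Fatou_newton_shift b c :
  cexp c = 1 -> disc c (1 / 6) `<=` Fatou (newton_shift b tau : C -> C).
Proof. by move=> c1; apply: Fatou_disc;
  [lra|exact: newton_shift_disc_normal]. Qed.

Let sixth : 0 < 1 / 6 :> R. Proof. by lra. Qed.

(** Forward invariance of the Fatou set reduces this to points far to the left,
    since each odd line is mapped into the next one, with its points moving to
    the left by at least 1. *)
Lemma odd_line_Julia b k z : (0 < b <= 2)%N ->
  odd_line k z -> ~ Fatou (newton_shift b tau) z.
Proof.
move=> b02 zk zF; pose n := Num.bound (`|complex.Re z + 520|).
have nz : complex.Re z + 520 <= n%:R.
  by rewrite (le_trans (ler_norm _))// ltW// archi_boundP.
pose w := iter n (newton_shift b tau) z.
have wE : w = iter (n * b) newton z + tau *+ n.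
  by rewrite /w iter_newton_shift// cexp_tau.
have [fk fRe] := iter_newton_odd_line (n * b) zk.
apply: (@far_left_odd_line_Julia R b (k + n) w b02).
- by rewrite /odd_line/= wE ImD Im_tau fk -mulrnDr addSn doubleD.
- rewrite wE ReD Re_tau addr0.
  have : n%:R <= (n * b)%:R :> R by rewrite ler_nat leq_pmulr//; case/andP: b02.
  lra.
- rewrite /w; elim: (n) => //= j IH.
  apply: newton_shift_image IH; first exact: cexp_tau.
  by move=> c c1; apply: Fatou_newton_shift c1 _ (disc_center _ sixth).
Qed.

Lemma disc_in_component (h : C -> C) : disc 0 (1 / 6) `<=` Fatou h ->
  disc 0 (1 / 6) `<=` connected_component (Fatou h) 0.
Proof.
move=> dF; apply: connected_component_max => //; first exact: disc_center.
by have [_ _ cd] := disc_domain (0 : C) sixth.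
Qed.

Lemma newton_lies_in_periodic :
  lies_in_periodic (newton_shift 1 0 : C -> C) (disc (0 : C) (1 / 6)).
Proof.
have dF := Fatou_newton cexp0; have F0 := dF _ (disc_center 0 sixth).
exists (connected_component (Fatou (newton_shift 1 0 : C -> C)) 0);
  last exact: disc_in_component.
split; first by exists 0.
have fix0 : iter 1 (newton_shift 1 0) 0 = 0 :> C.
  by rewrite /= /newton_shift/= newton0 addr0.
exists 1%N => //; rewrite -[X in image_component _ _ _ (_ X)]fix0.
apply: image_component_iter => //; first exact: continuous_newton_shift.
move=> w; apply: newton_shift_image; first exact: cexp0.
by move=> c c1; apply: (Fatou_newton c1); exact: disc_center.
Qed.

(** The images lie in the components of the points k tau.  If those of k tau and
    l tau met, with k < l, they would coincide, and their image under Im would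
    be an interval that contains (2k+1) pi. *)
Lemma newton_shift_lies_in_wandering b : (0 < b <= 2)%N ->
  lies_in_wandering (newton_shift b tau) (disc (0 : C) (1 / 6)).
Proof.
move=> b02; set h := newton_shift b tau;
  have dF := Fatou_newton_shift b (@cexp0 R).
have F0 := dF _ (disc_center 0 sixth).
exists (connected_component (Fatou h) 0); last exact: disc_in_component.
split; first by exists 0.
have orbit k : iter k h 0 = tau *+ k :> C.
  rewrite iter_newton_shift ?cexp_tau//.
  have -> : iter (k * b) newton 0 = 0 :> C by elim: (k * b)%N => //= n ->;
    exact: newton0.
  by rewrite add0r.
exists (fun k => connected_component (Fatou h) (iter k h 0)).
  move=> k; apply: image_component_iter => //;
    first exact: continuous_newton_shift.
  move=> w; apply: newton_shift_image; first exact: cexp_tau.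
  by move=> c c1; exact: (@Fatou_newton_shift b c c1 c (disc_center c sixth)).
have Ftau k : Fatou h (iter k h 0).
  rewrite orbit.
  have ck := cexp_mulrn k (@cexp_tau R).
  exact: (@Fatou_newton_shift b _ ck _ (disc_center _ sixth)).
suff disj k l : (k < l)%N -> connected_component (Fatou h) (iter k h 0) `&`
    connected_component (Fatou h) (iter l h 0) = set0.
  by move=> k l /eqP; rewrite neq_ltn => /orP[/disj//|/disj]; rewrite setIC.
move=> kl; rewrite -subset0 => z [kz lz].
have kl_conn : connected_component (Fatou h) (iter k h 0) (iter l h 0).
  exact: connected_component_trans kz (connected_component_sym lz).
have cIm : connected
    ((fun z : C => complex.Im z) @` connected_component (Fatou h) (iter k h 0)).
  apply: connected_continuous_connected; first exact: component_connected.
  apply: continuous_subspaceT => w A /nbhs_ballP[e e0 eA].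
  apply/nbhs_modulus; exists e => // w' ww'; apply: eA.
  by rewrite -ball_normE/= distrC (le_lt_trans _ ww')// -ImN -ImD modulus_Im.
have k_conn := connected_component_refl (Ftau k).
move/connected_intervalP: cIm => /(_ _ _ (ex_intro2 _ _ _ k_conn erefl)).
move=> /(_ _ (ex_intro2 _ _ _ kl_conn erefl)).
rewrite !orbit !Im_tau => /(_ (pi *+ k.*2.+1)) [].
  by rewrite !ler_pMn2l ?pi_gt0// leqnSn ltn_double.
move=> w /connected_component_sub wF wk; exact: (@odd_line_Julia b k w).
Qed.

(** If newton + s were a polynomial, newton - id would be one as well, with
    infinitely many zeros: the multiples of tau. *)
Lemma newton_plus_transcendental (s : C) :
  transcendental_entire (fun z : C => newton z + s : C).
Proof.
split.
  move=> z; apply: derivableD; [exact: newton_entire|exact: derivable_cst].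
move=> [p pE].
pose q : {poly R[i]} := p - s%:P - 'X.
have q0 : q = 0.
  pose rs := [seq (tau *+ n : R[i]) | n <- iota 0 (size q)].
  apply: (@roots_geq_poly_eq0 _ q rs).
  - apply/allP => _ /mapP[n _ ->]; rewrite rootE /q !hornerE -pE.
    rewrite -[X in newton X]add0r newton_period ?newton0;
      last exact: cexp_mulrn cexp_tau.
    by rewrite add0r addrK subrr.
  - rewrite map_inj_uniq ?iota_uniq// => m n mn.
    have := congr1 (@complex.Im R) mn; rewrite !Im_tau.
    by move/mulrIn => /(_ (lt0r_neq0 (pi_gt0 R)))/double_inj.
  - by rewrite size_map size_iota.
have := pE (- 1);
have -> : p = 'X + s%:P by move/eqP: q0; rewrite /q subr_eq0 subr_eq => /eqP.
rewrite !hornerE /newton opprK => /addIr e.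
have : cexp 1 = 1 :> R[i] by rewrite -[LHS](addKr (- 1 - 1)) e; ring.
move=> /(congr1 (@Normc.normc R)); rewrite modulus_cexp Normc.normc1 /= => e1.
by have := expR_ge1Dx (1 : R); rewrite e1; lra.
Qed.

End Main.

Theorem theorem2p7 (R : realType) :
  exists (f g : R[i]^o -> R[i]^o) (D : set R[i]^o),
    [/\ transcendental_entire f, transcendental_entire g & domain D] /\
    [/\ lies_in_periodic f D, lies_in_wandering g D,
        lies_in_wandering (g \o f) D & lies_in_wandering (f \o g) D].
Proof.
exists (newton_shift 1 0), (newton_shift 1 tau), (disc 0 (1 / 6)).
have gf : newton_shift 1 tau \o newton_shift 1 0 =
    newton_shift 2 tau :> (R[i]^o -> R[i]^o).
  by apply/funext => z; rewrite /newton_shift/= addr0.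
have fg : newton_shift 1 0 \o newton_shift 1 tau =
    newton_shift 2 tau :> (R[i]^o -> R[i]^o).
  by apply/funext => z; rewrite /newton_shift/= addr0 newton_period ?cexp_tau.
rewrite gf fg; split; split.
- exact: newton_plus_transcendental.
- exact: newton_plus_transcendental.
- by apply: disc_domain; lra.
- exact: newton_lies_in_periodic.
- exact: newton_shift_lies_in_wandering.
- exact: newton_shift_lies_in_wandering.
- exact: newton_shift_lies_in_wandering.
Qed.
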